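(* Let $\mathcal{A},\mathcal{B}$ be unital $C^*$-algebras and let $\phi:\mathcal{A}\to\mathcal{B}$ be a unital $*$-homomorphism. Then there is a canonical map $$\langle\Phi,\mathcal{G}_\phi\rangle=\mathcal{G}_\phi\circ\Phi^*:\underline{\Sigma}^{\mathcal{B}}\longrightarrow\underline{\Sigma}^{\mathcal{A}}$$ in the opposite direction between the associated spectral presheaves. Here $\Phi:\mathbf{Set}^{\mathcal{C}(\mathcal{A})^{op}}\to\mathbf{Set}^{\mathcal{C}(\mathcal{B})^{op}}$ is the essential geometric morphism induced by the order-preserving map $\tilde\phi:\mathcal{C}(\mathcal{A})\to\mathcal{C}(\mathcal{B})$, $C\mapsto\phi(C)$, with inverse image functor $\Phi^*(\underline{P})=\underline{P}\circ\tilde\phi$, and $\mathcal{G}_\phi:\Phi^*(\underline{\Sigma}^{\mathcal{B}})\to\underline{\Sigma}^{\mathcal{A}}$ is the natural transformation with components $$\mathcal{G}_{\phi;C}:\Phi^*(\underline{\Sigma}^{\mathcal{B}})_C=\Sigma(\phi(C))\to\Sigma(C)=\underline{\Sigma}^{\mathcal{A}}_C,\qquad \lambda\mapsto\lambda\circ\phi|_C\qquad(C\in\mathcal{C}(\mathcal{A})).$$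
   Context: For a unital $C^*$-algebra $\mathcal{A}$, the context category $\mathcal{C}(\mathcal{A})$ is the set of unital abelian $C^*$-subalgebras of $\mathcal{A}$ that share the unit element with $\mathcal{A}$ (including $\mathbb{C}1$), partially ordered by inclusion and regarded as a category. For a unital abelian $C^*$-algebra $C$, $\Sigma(C)$ denotes its Gelfand spectrum, the set of characters $\lambda:C\to\mathbb{C}$ with the relative weak$^*$-topology. The spectral presheaf $\underline{\Sigma}^{\mathcal{A}}$ is the presheaf over $\mathcal{C}(\mathcal{A})$ with $\underline{\Sigma}^{\mathcal{A}}_C=\Sigma(C)$ and, for each inclusion $C'\subseteq C$, restriction map $\Sigma(C)\to\Sigma(C')$, $\lambda\mapsto\lambda|_{C'}$. A map $\langle\Phi,\mathcal{G}\rangle:\underline{\Sigma}^{\mathcal{B}}\to\underline{\Sigma}^{\mathcal{A}}$ between spectral presheaves means a pair consisting of an essential geometric morphism $\Phi:\mathbf{Set}^{\mathcal{C}(\mathcal{A})^{op}}\to\mathbf{Set}^{\mathcal{C}(\mathcal{B})^{op}}$ and a natural transformation $\mathcal{G}:\Phi^*(\underline{\Sigma}^{\mathcal{B}})\to\underline{\Sigma}^{\mathcal{A}}$. *)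

(* Defs.v *)
From HB Require Import structures.
From mathcomp Require Import all_boot all_order all_algebra.
From mathcomp Require Import complex.
From mathcomp Require Import all_classical all_reals all_analysis.

Set Implicit Arguments.
Unset Strict Implicit.
Unset Printing Implicit Defensive.

Import Order.TTheory GRing.Theory Num.Theory.
Import numFieldNormedType.Exports.

Local Open Scope classical_set_scope.
Local Open Scope ring_scope.
Local Open Scope complex_scope.

Record category := Category {
  obj :> Type;
  hom : obj -> obj -> Type;
  idm : forall a, hom a a;
  comp : forall a b c, hom b c -> hom a b -> hom a c;
  comp_idl : forall a b (f : hom a b), comp (idm b) f = f;
  comp_idr : forall a b (f : hom a b), comp f (idm a) = f;
  compA : forall a b c d (f : hom c d) (g : hom b c) (h : hom a b),
    comp f (comp g h) = comp (comp f g) h }.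
Arguments idm {c0} a.

Notation "f '\;c' g" := (comp g f) (at level 50, left associativity).

Record functor (C D : category) := Functor {
  fobj :> C -> D;
  fmap : forall a b, hom a b -> hom (fobj a) (fobj b);
  fmap_id : forall a, fmap (idm a) = idm (fobj a);
  fmap_comp : forall a b c (f : hom a b) (g : hom b c),
    fmap (f \;c g) = fmap f \;c fmap g }.

Record nat_trans (C D : category) (F G : functor C D) := NatTrans {
  component :> forall a, hom (F a) (G a);
  naturality : forall a b (f : hom a b),
    fmap F f \;c component b = component a \;c fmap G f }.

Lemma nat_trans_ext (C D : category) (F G : functor C D)
  (s t : nat_trans F G) : (forall a, s a = t a) -> s = t.
Proof.
case: s t => [s sn] [t tn] /= st.
have {}st : s = t by exact: functional_extensionality_dep.
by case: t / st tn => tn; congr NatTrans; exact: Prop_irrelevance.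
Qed.

Section functor_category.
Variables C D : category.

Program Definition id_trans (F : functor C D) : nat_trans F F :=
  @NatTrans _ _ F F (fun a => idm (F a)) _.
Next Obligation. by move=> F a b f; rewrite comp_idl comp_idr. Qed.

Program Definition comp_trans (F G H : functor C D)
    (t : nat_trans G H) (s : nat_trans F G) : nat_trans F H :=
  @NatTrans _ _ F H (fun a => s a \;c t a) _.
Next Obligation.
by move=> F G H t s a b f; rewrite -compA naturality compA naturality -compA.
Qed.

Program Definition functor_category : category :=
  @Category (functor C D) (@nat_trans C D) id_trans comp_trans _ _ _.
Next Obligation. by move=> F G f; apply: nat_trans_ext => a; exact: comp_idl. Qed.
Next Obligation. by move=> F G f; apply: nat_trans_ext => a; exact: comp_idr. Qed.
Next Obligation. by move=> *; apply: nat_trans_ext => a; exact: compA. Qed.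

End functor_category.

Definition opposite (C : category) : category :=
  @Category C (fun a b => @hom C b a) (@idm C) (fun a b c f g => f \;c g)
    (fun a b f => comp_idr f) (fun a b f => comp_idl f)
    (fun a b c d f g h => esym (compA h g f)).

Definition opposite_functor (C D : category) (F : functor C D) :
    functor (opposite C) (opposite D) :=
  @Functor (opposite C) (opposite D) F (fun a b f => fmap F f)
    (fmap_id F) (fun a b c f g => fmap_comp F g f).

Program Definition comp_functor (C D E : category)
    (G : functor D E) (F : functor C D) : functor C E :=
  @Functor C E (fun a => G (F a)) (fun a b f => fmap G (fmap F f)) _ _.
Next Obligation. by move=> C D E G F a; rewrite /= !fmap_id. Qed.
Next Obligation. by move=> C D E G F a b c f g; rewrite /= !fmap_comp. Qed.

Definition sets : category :=
  @Category Type (fun X Y => X -> Y) (fun X x => x) (fun X Y Z g f x => g (f x))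
    (fun _ _ _ => erefl) (fun _ _ _ => erefl) (fun _ _ _ _ _ _ _ => erefl).

Definition presheaves (C : category) : category :=
  functor_category (opposite C) sets.

Program Definition precomp (C D : category) (F : functor C D) :
    functor (presheaves D) (presheaves C) :=
  @Functor (presheaves D) (presheaves C)
    (fun P : presheaves D => comp_functor P (opposite_functor F))
    (fun P Q t =>
       @NatTrans _ _ (comp_functor P (opposite_functor F))
         (comp_functor Q (opposite_functor F)) (fun a => component t (F a)) _)
    _ _.
Next Obligation. by move=> C D F P Q t a b f; exact: (naturality (t : nat_trans _ _)). Qed.
Next Obligation. by move=> C D F P; exact: nat_trans_ext. Qed.
Next Obligation. by move=> C D F P Q S s t; exact: nat_trans_ext. Qed.

Record cone (J C : category) (D : functor J C) := Cone {
  apex : C;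
  leg : forall j, hom apex (D j);
  leg_comm : forall i j (u : hom i j), leg i \;c fmap D u = leg j }.

Definition is_limit (J C : category) (D : functor J C) (c : cone D) : Prop :=
  forall c' : cone D, exists! u : hom (apex c') (apex c),
    forall j, u \;c leg c j = leg c' j.

Program Definition map_cone (J C E : category) (F : functor C E)
    (D : functor J C) (c : cone D) : cone (comp_functor F D) :=
  @Cone _ _ (comp_functor F D) (F (apex c)) (fun j => fmap F (leg c j)) _.
Next Obligation.
by move=> J C E F D c i j u; rewrite /= -fmap_comp leg_comm.
Qed.

Definition finite_type (T : Type) : Prop :=
  exists (n : nat) (f : 'I_n -> T), forall x, exists i, f i = x.

Definition finite_category (J : category) : Prop :=
  finite_type J /\ forall i j : J, finite_type (hom i j).

Definition left_exact (C E : category) (F : functor C E) : Prop :=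
  forall J, finite_category J -> forall (D : functor J C) (c : cone D),
    is_limit c -> is_limit (map_cone F c).

Record adjunction (C D : category) (L : functor C D) (U : functor D C) :=
  Adjunction {
  transpose : forall c d, hom (L c) d -> hom c (U d);
  untranspose : forall c d, hom c (U d) -> hom (L c) d;
  transposeK : forall c d, cancel (@transpose c d) (@untranspose c d);
  untransposeK : forall c d, cancel (@untranspose c d) (@transpose c d);
  transpose_natural : forall c c' d d' (u : hom c' c) (f : hom (L c) d)
      (v : hom d d'),
    transpose (fmap L u \;c f \;c v) = u \;c transpose f \;c fmap U v }.

(* An essential geometric morphism from E to F goes in the direction of its
   direct image; here Fs is its inverse image. *)
Record essential_geometric (E F : category) (Fs : functor F E) :=
  EssentialGeometric {
  direct_image : functor E F;
  inverse_direct : adjunction Fs direct_image;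
  inverse_lex : left_exact Fs;
  left_image : functor E F;
  left_inverse : adjunction left_image Fs }.

Record essential_geometric_morphism (E F : category) :=
  EssentialGeometricMorphism {
  inverse_image : functor F E;
  inverse_imageP : essential_geometric inverse_image }.

(* The geometric morphism goes from presheaves over C to presheaves over D, so
   that its inverse image pulls P back to a presheaf over C. *)
Record presheaf_map (D C : category) (P : presheaves D) (Q : presheaves C) :=
  PresheafMap {
  map_geom : essential_geometric_morphism (presheaves C) (presheaves D);
  map_trans : nat_trans (inverse_image map_geom P) Q }.

Section preorder.
Variables (T : Type) (le : T -> T -> Prop).
Hypothesis le_refl : forall x, le x x.
Hypothesis le_trans : forall x y z, le y z -> le x y -> le x z.

Definition preorder_category : category :=
  @Category T le le_refl le_trans (fun _ _ _ => Prop_irrelevance _ _)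
    (fun _ _ _ => Prop_irrelevance _ _)
    (fun _ _ _ _ _ _ _ => Prop_irrelevance _ _).

End preorder.

(* MathComp has no join of its ring structures with its normed ones, hence the
   multiplication and the unit below. The zero algebra is allowed. The norm
   takes its values in R[i], as in every normed module over R[i]. *)
HB.mixin Record isCStarAlgebra (R : realType) A
    of CompleteNormedModule R[i] A := {
  cmul : A -> A -> A;
  cunit : A;
  cmulA : associative cmul;
  cmul1x : left_id cunit cmul;
  cmulx1 : right_id cunit cmul;
  cmulDl : left_distributive cmul +%R;
  cmulDr : right_distributive cmul +%R;
  cmulZl : forall (a : R[i]) x y, cmul (a *: x) y = a *: cmul x y;
  cmulZr : forall (a : R[i]) x y, cmul x (a *: y) = a *: cmul x y;
  star : A -> A;
  starK : involutive star;
  starD : {morph star : x y / x + y};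
  starZ : forall (a : R[i]) x, star (a *: x) = a^* *: star x;
  starM : forall x y, star (cmul x y) = cmul (star y) (star x);
  norm_cmul_le : forall x y, `|cmul x y| <= `|x| * `|y|;
  norm_star : forall x, `|cmul (star x) x| = `|x| ^+ 2 }.

#[short(type="cstarAlgType")]
HB.structure Definition CStarAlgebra (R : realType) :=
  { A of isCStarAlgebra R A & CompleteNormedModule R[i] A }.

Notation "x '\*c' y" := (cmul x y) (at level 40, left associativity).

Section context.
Variables (R : realType) (A : cstarAlgType R).

Record context := Context {
  carrier :> set A;
  context1 : carrier cunit;
  contextD : forall x y, carrier x -> carrier y -> carrier (x + y);
  contextZ : forall (a : R[i]) x, carrier x -> carrier (a *: x);
  contextM : forall x y, carrier x -> carrier y -> carrier (x \*c y);
  context_star : forall x, carrier x -> carrier (star x);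
  context_closed : closed carrier;
  context_comm : forall x y, carrier x -> carrier y -> x \*c y = y \*c x }.

Definition context_category : category :=
  preorder_category (le := fun C' C : context => C' `<=` C)
    (fun _ => @subset_refl _ _)
    (fun _ _ _ CD BC => subset_trans BC CD).

Definition context_type (C : context) : Type := {x : A | x \in carrier C}.

Section context_algebra.
Variable C : context.
HB.instance Definition _ := SubChoice.on (context_type C).

Lemma context_submod_closed : subsemimod_closed [in carrier C].
Proof.
split; last by move=> a x; rewrite !inE; exact: contextZ.
split=> [|x y]; rewrite !inE; last exact: contextD.
by rewrite -(scale0r cunit); apply: contextZ; exact: context1.
Qed.
HB.instance Definition _ := GRing.SubChoice_isSubLmodule.Build R[i] A
  [in carrier C] (context_type C) context_submod_closed.

Definition context_one : context_type C := Sub cunit (mem_set (context1 C)).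
Definition context_mul (x y : context_type C) : context_type C :=
  Sub (val x \*c val y) (mem_set (contextM (set_mem (valP x)) (set_mem (valP y)))).

Lemma context_mulA : associative context_mul.
Proof. by move=> x y z; apply: val_inj; rewrite !SubK cmulA. Qed.
Lemma context_mulC : commutative context_mul.
Proof.
move=> x y; apply: val_inj; rewrite !SubK.
by apply: (@context_comm C); apply: set_mem; exact: valP.
Qed.
Lemma context_mul1 : left_id context_one context_mul.
Proof. by move=> x; apply: val_inj; rewrite !SubK cmul1x. Qed.
Lemma context_mulDl : left_distributive context_mul +%R.
Proof. by move=> x y z; apply: val_inj; rewrite raddfD !SubK cmulDl. Qed.
HB.instance Definition _ := GRing.Zmodule_isComPzRing.Build (context_type C)
  context_mulA context_mulC context_mul1 context_mulDl.

End context_algebra.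

(* A character preserves the unit, hence is nonzero; its continuity and its
   compatibility with star are automatic. *)
Record spectrum (C : context) := Character {
  character :> context_type C -> R[i];
  character_linear : scalar character;
  character_mul : monoid_morphism character }.

Lemma spectrum_ext (C : context) (l m : spectrum C) : l =1 m -> l = m.
Proof.
case: l m => [l ll lm] [m ml mm] /= /funext e; case: m / e ml mm => ml mm.
by congr Character; exact: Prop_irrelevance.
Qed.

HB.instance Definition _ (C : context) := gen_eqMixin (spectrum C).
HB.instance Definition _ (C : context) := gen_choiceMixin (spectrum C).

(* The relative weak* topology, that is, pointwise convergence on C. *)
HB.instance Definition _ (C : context) := Topological.copy (spectrum C)
  (initial_topology (@character C : spectrum C -> {ptws context_type C -> R[i]^o})).

Definition inclusion (C' C : context) (CC : C' `<=` C) (x : context_type C') :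
  context_type C := Sub (val x) (mem_set (CC _ (set_mem (valP x)))).

Program Definition restrict (C' C : context) (CC : C' `<=` C) (l : spectrum C) :
  spectrum C' := @Character C' (l \o inclusion CC) _ _.
Next Obligation.
move=> C' C CC l a x y /=; rewrite -character_linear; congr (l _).
exact: val_inj.
Qed.
Next Obligation.
move=> C' C CC l; have [l1 lM] := character_mul l.
split=> [|x y] /=; first by rewrite -l1; congr (l _); exact: val_inj.
by rewrite -lM; congr (l _); exact: val_inj.
Qed.

Program Definition spectral_presheaf : presheaves context_category :=
  @Functor (opposite context_category) sets (fun C => spectrum C)
    (fun C C' CC => restrict CC) _ _.
Next Obligation.
move=> C; apply: funext => l; apply: spectrum_ext => x /=.
by congr (l _); exact: val_inj.
Qed.
Next Obligation.
move=> C3 C2 C1 C21 C32; apply: funext => l; apply: spectrum_ext => x /=.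
by congr (l _); exact: val_inj.
Qed.

End context.

Definition spectral_presheaf_map (R : realType) (B A : cstarAlgType R) :=
  presheaf_map (spectral_presheaf B) (spectral_presheaf A).

Record star_morphism (R : realType) (A B : cstarAlgType R) := StarMorphism {
  star_fun :> A -> B;
  star_linear : linear star_fun;
  star_unit : star_fun cunit = cunit;
  star_mul : {morph star_fun : x y / x \*c y};
  star_star : {morph star_fun : x / star x} }.

Section induced.
Variables (R : realType) (A B : cstarAlgType R) (phi : star_morphism A B).

Lemma corestriction_subproof (C : context A) (D : context B)
  (phiC : phi @` C = D) (x : context_type C) : phi (val x) \in carrier D.
Proof. by rewrite -phiC; apply/mem_set/imageP/set_mem; exact: valP. Qed.

Definition corestriction (C : context A) (D : context B)
    (phiC : phi @` C = D) (x : context_type C) : context_type D :=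
  Sub (phi (val x)) (corestriction_subproof phiC x).

Definition monotone_functor (f : context A -> context B)
    (f_mono : forall C' C : context A, C' `<=` C -> f C' `<=` f C) :
    functor (context_category A) (context_category B) :=
  @Functor (context_category A) (context_category B) f f_mono
    (fun C => Prop_irrelevance (f_mono C C (@subset_refl _ _)) _)
    (fun C1 C2 C3 h k => Prop_irrelevance (f_mono C1 C3 (subset_trans h k)) _).

End induced.

(* Main.v *)
Require Import Defs.
From HB Require Import structures.
From mathcomp Require Import all_boot all_order all_algebra.
From mathcomp Require Import generic_quotient complex ring lra.
From mathcomp Require Import all_classical all_reals all_analysis.

Set Implicit Arguments.
Unset Strict Implicit.
Unset Printing Implicit Defensive.

Import Order.TTheory GRing.Theory Num.Theory.
Import numFieldNormedType.Exports.

Local Open Scope classical_set_scope.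
Local Open Scope ring_scope.

(* The category of contexts is a preorder small enough for presheaves on it to
   have both Kan extensions along the image map, which makes precomposition the
   inverse image of an essential geometric morphism; being a right adjoint, it
   preserves limits.

   The point of substance is that the image of a context C under phi is closed.
   First, phi is contractive: a self-adjoint a with |a| < 1 is the real part of
   a unitary, which phi maps to a unitary, and the C*-identity reduces the
   general case to this one. Next, a self-adjoint a with |phi a| <= r can be
   replaced by f = a (1 - i s a)^-1 with s of order 1/r, which is bounded by a
   multiple of r and whose image is close to phi a, since (1 - i s a)^-1 is
   bounded by an absolute constant. Hence every point of the closure of phi(C)
   is approximated, with a relative error below 1, by the image of an element
   of C of comparable norm; iterating and summing the resulting geometric series
   in C exhibits the point as an image. *)

(** * Kan extensions of presheaves along monotone maps *)

Section right_adjoint.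
(* MathComp shadows hom, comp and fmap. *)
Import Defs.
Variables (C D : category) (L : functor C D) (U : functor D C).
Variable adj : adjunction L U.

Lemma transpose_compr (c : C) (d d' : D) (f : hom (L c) d) (v : hom d d') :
  transpose adj (f \;c v) = transpose adj f \;c fmap U v.
Proof.
have := transpose_natural adj (idm c) f v.
by rewrite fmap_id !comp_idr.
Qed.

Lemma untranspose_compr (c : C) (d d' : D) (g : hom c (U d)) (v : hom d d') :
  untranspose adj (g \;c fmap U v) = untranspose adj g \;c v.
Proof.
apply: (can_inj (@transposeK _ _ _ _ adj _ _)).
by rewrite transpose_compr !untransposeK.
Qed.

(** A cone over the image diagram transposes to a cone over [F]; the arrow that mediates it
    transposes back to the one required. *)
Lemma right_adjoint_limit (J : category) (F : functor J D) (k : cone F) :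
  is_limit k -> is_limit (map_cone U k).
Proof.
move=> klim k'.
have legL i j (u : hom i j) :
    untranspose adj (leg k' i) \;c fmap F u = untranspose adj (leg k' j).
  by rewrite -untranspose_compr -(leg_comm k' u).
have [v [vk vuniq]] := klim (Cone legL).
exists (transpose adj v); split=> [j /=|w wk].
  by rewrite -transpose_compr vk untransposeK.
rewrite (vuniq (untranspose adj w)) ?untransposeK// => j /=.
by rewrite -untranspose_compr wk.
Qed.

End right_adjoint.

Section presheaf.
Import Defs.
Variables (E : category) (P : functor (opposite E) sets).

Definition res (x y : E) (h : hom x y) : P y -> P x := @fmap _ _ P y x h.

Lemma res_id x p : res (idm x) p = p.
Proof. by rewrite /res (fmap_id P). Qed.

Lemma res_comp x y z (h : hom y z) (k : hom x y) p :
  res k (res h p) = res (k \;c h) p.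
Proof. by rewrite /res [in RHS](@fmap_comp _ _ P z y x). Qed.

End presheaf.

Lemma res_nat (E : category) (P Q : functor (opposite E) sets)
    (t : nat_trans P Q) (x y : E) (h : Defs.hom x y) (p : P y) :
  t x (res h p) = res h (t y p).
Proof. exact: (congr1 (@^~ p) (@naturality _ _ _ _ t y x h)). Qed.

Section kan.
Import Defs.
Local Open Scope quotient_scope.
Variables (S T : Type) (leS : S -> S -> Prop) (leT : T -> T -> Prop).
Variables (leS_refl : forall x, leS x x) (leT_refl : forall x, leT x x).
Variable leS_trans : forall x y z, leS y z -> leS x y -> leS x z.
Variable leT_trans : forall x y z, leT y z -> leT x y -> leT x z.

Let C := preorder_category leS_refl leS_trans.
Let D := preorder_category leT_refl leT_trans.
Variable F : functor C D.

Let le_eq (x y : D) (h k : hom x y) : h = k.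
Proof. exact: (@Prop_irrelevance (leT x y) h k). Qed.

(** * Right Kan extension *)

Section right_kan.

(** These families are the natural transformations from [Hom(F -, d)] to [P], that is, the pointwise
    limit formula for the right Kan extension. Arrows of [D] being unique, [h'] is quantified
    instead of composed from [u] and [h]. *)
Definition compatible (P : functor (opposite C) sets) (d : T)
    (s : forall c : S, leT (F c) d -> P c) :=
  forall (c' c : C) (u : hom c' c) (h : leT (F c) d) (h' : leT (F c') d),
    res u (s c h) = s c' h'.

Definition right_kan_obj (P : functor (opposite C) sets) (d : T) : Type :=
  {s : forall c : S, leT (F c) d -> P c | compatible s}.

Lemma right_kan_ext P d (s t : right_kan_obj P d) :
  (forall c h, sval s c h = sval t c h) -> s = t.
Proof.
case: s t => [s sP] [t tP] /= st; apply: eq_exist.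
by apply: functional_extensionality_dep => c; apply: functional_extensionality_dep.
Qed.

Definition right_kan_res P d' d (h : leT d' d) (s : right_kan_obj P d) :
  right_kan_obj P d' :=
  exist (@compatible P d') (fun c k => sval s c (leT_trans h k))
    (fun c' c u k k' =>
       proj2_sig s c' c u (leT_trans h k) (leT_trans h k')).

Program Definition right_kan_presheaf (P : functor (opposite C) sets) :
    functor (opposite D) sets :=
  @Functor (opposite D) sets (right_kan_obj P)
    (fun d d' h => right_kan_res h) _ _.
Next Obligation.
move=> P d; apply: funext => s; apply: right_kan_ext => c h /=.
by congr (sval s c _); exact: le_eq.
Qed.
Next Obligation.
move=> P d1 d2 d3 h k; apply: funext => s; apply: right_kan_ext => c l /=.
by congr (sval s c _); exact: le_eq.
Qed.

Program Definition right_kan_trans (P Q : functor (opposite C) sets)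
    (t : nat_trans P Q) : nat_trans (right_kan_presheaf P) (right_kan_presheaf Q) :=
  @NatTrans _ _ (right_kan_presheaf P) (right_kan_presheaf Q)
    (fun d s => exist (@compatible Q d) (fun c h => t c (sval s c h)) _) _.
Next Obligation.
move=> P Q t d s c' c u h h' /=; rewrite -res_nat; congr (t _ _).
exact: (proj2_sig s).
Qed.
Next Obligation.
by move=> P Q t d d' h; apply: funext => s; exact: right_kan_ext.
Qed.

Program Definition right_kan : functor (presheaves C) (presheaves D) :=
  @Functor (presheaves C) (presheaves D) right_kan_presheaf
    (fun P Q t => right_kan_trans t) _ _.
Next Obligation.
move=> P; apply: nat_trans_ext => d; apply: funext => s.
exact: right_kan_ext.
Qed.
Next Obligation.
move=> P Q W s t; apply: nat_trans_ext => d; apply: funext => x.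
exact: right_kan_ext.
Qed.

Program Definition right_kan_transpose (Q : functor (opposite D) sets)
    (P : functor (opposite C) sets) (t : nat_trans (precomp F Q) P) :
    nat_trans Q (right_kan_presheaf P) :=
  @NatTrans _ _ Q (right_kan_presheaf P)
    (fun d q => exist (@compatible P d) (fun c h => t c (@res D Q (F c) d h q)) _) _.
Next Obligation.
move=> Q P t d q c' c u h h' /=; rewrite -res_nat; congr (t _ _).
have -> : h' = fmap F u \;c (h : hom (F c) d) by exact: le_eq.
exact: (@res_comp D Q _ _ _ h (fmap F u)).
Qed.
Next Obligation.
move=> Q P t d d' h; apply: funext => q; apply: right_kan_ext => c k /=.
congr (t _ _); exact: (@res_comp D Q).
Qed.

Program Definition right_kan_untranspose (Q : functor (opposite D) sets)
    (P : functor (opposite C) sets) (t : nat_trans Q (right_kan_presheaf P)) :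
    nat_trans (precomp F Q) P :=
  @NatTrans _ _ (precomp F Q) P (fun c q => sval (t (F c) q) c (leT_refl _)) _.
Next Obligation.
move=> Q P t c c' u; apply: funext => q /=.
rewrite -/(res (fmap F u) q) res_nat /=.
rewrite [RHS](proj2_sig (t (F c) q) c' c u (leT_refl _) (fmap F u)).
by congr (sval _ _ _); exact: le_eq.
Qed.

Program Definition right_kan_adjunction : adjunction (precomp F) right_kan :=
  @Adjunction (presheaves D) (presheaves C) (precomp F) right_kan
    right_kan_transpose right_kan_untranspose _ _ _.
Next Obligation.
move=> Q P t; apply: nat_trans_ext => c; apply: funext => q /=.
by rewrite (res_id (P := Q) (x := F c)).
Qed.
Next Obligation.
move=> Q P t; apply: nat_trans_ext => d; apply: funext => q.
apply: right_kan_ext => c h /=.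
by rewrite res_nat /=; congr (sval _ _ _); exact: le_eq.
Qed.
Next Obligation.
move=> Q Q' P P' u t v; apply: nat_trans_ext => d; apply: funext => q.
apply: right_kan_ext => c h /=.
by rewrite res_nat.
Qed.

End right_kan.

(** * Left Kan extension *)

Section left_kan_quotient.
Variables (P : functor (opposite C) sets) (d : T).

(** Points of the disjoint union whose quotient is the colimit of [P] over all [c] with
    [d <= F c]. *)
Record left_kan_pre := LeftKanPre {
  pre_index : S;
  pre_le : leT d (F pre_index);
  pre_val : P pre_index }.

HB.instance Definition _ := gen_eqMixin left_kan_pre.
HB.instance Definition _ := gen_choiceMixin left_kan_pre.

Definition invariant (X : Type) (f : left_kan_pre -> X) :=
  forall (c' c : C) (u : hom c' c) (h : leT d (F c)) (h' : leT d (F c')) p,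
    f (LeftKanPre h p) = f (LeftKanPre h' (res u p)).

(* The equivalence relation generated by the identifications of the colimit:
   two points are related when no invariant predicate separates them. *)
Definition left_kan_rel (x y : left_kan_pre) : bool :=
  `[< forall f : left_kan_pre -> Prop, invariant f -> f x = f y >].

Lemma left_kan_rel_equiv : equiv_class_of left_kan_rel.
Proof.
split=> [x|x y|y x z /asboolP xy /asboolP yz]; first exact/asboolP.
  by apply/asboolP/asboolP => xy f inv; rewrite xy.
by apply/asboolP => f inv; rewrite xy// yz.
Qed.

Canonical left_kan_equiv := EquivRelPack left_kan_rel_equiv.

Definition left_kan_obj : Type := {eq_quot left_kan_equiv}.

Definition left_kan_class (x : left_kan_pre) : left_kan_obj :=
  \pi_({eq_quot left_kan_equiv}) x.

Lemma left_kan_class_invariant : invariant left_kan_class.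
Proof.
move=> c' c u h h' p; apply/eqmodP/asboolP => f inv; exact: inv.
Qed.

(** Evaluating at the chosen representative makes sense for every [f], so invariance is asked for
    only in the computation rule. *)
Definition left_kan_lift (X : Type) (f : left_kan_pre -> X) (q : left_kan_obj) :=
  f (repr (q : {eq_quot left_kan_equiv})).

Lemma left_kan_liftE (X : Type) (f : left_kan_pre -> X) x :
  invariant f -> left_kan_lift f (left_kan_class x) = f x.
Proof.
move=> inv; rewrite /left_kan_lift.
have /eqmodP/asboolP : \pi_({eq_quot left_kan_equiv}) (repr (left_kan_class x))
    = \pi_({eq_quot left_kan_equiv}) x by rewrite reprK.
(* The predicate [f y = f x] inherits invariance from [f] and holds at [x], hence at the
   representative of its class. *)
move=> /(_ (fun y => f y = f x)) -> // c' c u h h' p.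
by rewrite (inv c' c u h h').
Qed.

Lemma left_kan_ind (Z : left_kan_obj -> Prop) :
  (forall c (h : leT d (F c)) p, Z (left_kan_class (LeftKanPre h p))) ->
  forall q, Z q.
Proof.
move=> Zc q; rewrite -[q](@reprK _ {eq_quot left_kan_equiv}).
by case: (repr _).
Qed.

End left_kan_quotient.

Definition left_kan_pre_res (P : functor (opposite C) sets) d' d
    (h : leT d' d) (x : left_kan_pre P d) : left_kan_pre P d' :=
  LeftKanPre (leT_trans (pre_le x) h) (pre_val x).

Definition left_kan_res (P : functor (opposite C) sets) d' d (h : leT d' d) :
    left_kan_obj P d -> left_kan_obj P d' :=
  left_kan_lift (fun x => left_kan_class (left_kan_pre_res h x)).

Lemma left_kan_resE (P : functor (opposite C) sets) d' d (h : leT d' d) x :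
  left_kan_res h (left_kan_class x) =
    left_kan_class (left_kan_pre_res h x) :> left_kan_obj P d'.
Proof.
by apply: left_kan_liftE => c2 c1 u k k1 p; exact: left_kan_class_invariant.
Qed.

Lemma left_kan_class_eq (P : functor (opposite C) sets) d c
    (h h' : leT d (F c)) (p : P c) :
  left_kan_class (LeftKanPre h p) = left_kan_class (LeftKanPre h' p).
Proof. by rewrite (@Prop_irrelevance _ h h'). Qed.

Program Definition left_kan_presheaf (P : functor (opposite C) sets) :
    functor (opposite D) sets :=
  @Functor (opposite D) sets (left_kan_obj P)
    (fun d d' h => @left_kan_res P d' d h) _ _.
Next Obligation.
move=> P d; apply: funext; apply: left_kan_ind => c h p.
by rewrite left_kan_resE; exact: left_kan_class_eq.
Qed.
Next Obligation.
move=> P d1 d2 d3 h k; apply: funext; apply: left_kan_ind => c l p /=.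
by rewrite !left_kan_resE; exact: left_kan_class_eq.
Qed.

Definition left_kan_map (P Q : functor (opposite C) sets)
    (t : nat_trans P Q) d : left_kan_obj P d -> left_kan_obj Q d :=
  left_kan_lift
    (fun x => left_kan_class (LeftKanPre (pre_le x) (t _ (pre_val x)))).

Lemma left_kan_mapE (P Q : functor (opposite C) sets) (t : nat_trans P Q) d
    c (h : leT d (F c)) p :
  left_kan_map t (left_kan_class (LeftKanPre h p)) =
    left_kan_class (LeftKanPre h (t c p)).
Proof.
rewrite /left_kan_map left_kan_liftE// => c1 c2 u l l' p' /=.
by rewrite res_nat; exact: left_kan_class_invariant.
Qed.

Program Definition left_kan_trans (P Q : functor (opposite C) sets)
    (t : nat_trans P Q) : nat_trans (left_kan_presheaf P) (left_kan_presheaf Q) :=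
  @NatTrans _ _ (left_kan_presheaf P) (left_kan_presheaf Q)
    (left_kan_map t) _.
Next Obligation.
move=> P Q t d d' h; apply: funext; apply: left_kan_ind => c l p /=.
by rewrite left_kan_mapE !left_kan_resE left_kan_mapE.
Qed.

Program Definition left_kan : functor (presheaves C) (presheaves D) :=
  @Functor (presheaves C) (presheaves D) left_kan_presheaf
    (fun P Q t => left_kan_trans t) _ _.
Next Obligation.
move=> P; apply: nat_trans_ext => d; apply: funext.
apply: left_kan_ind => c h p /=.
by rewrite left_kan_mapE.
Qed.
Next Obligation.
move=> P Q W s t; apply: nat_trans_ext => d; apply: funext.
by apply: left_kan_ind => c h p /=; rewrite !left_kan_mapE.
Qed.

Program Definition left_kan_transpose (P : functor (opposite C) sets)
    (Q : functor (opposite D) sets) (t : nat_trans (left_kan_presheaf P) Q) :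
    nat_trans P (precomp F Q) :=
  @NatTrans _ _ P (precomp F Q)
    (fun c p => t (F c) (left_kan_class (LeftKanPre (leT_refl _) p))) _.
Next Obligation.
move=> P Q t c c' u; apply: funext => p /=.
rewrite -/(res (fmap F u) _) -res_nat; congr (t _ _).
by rewrite [RHS]left_kan_resE; symmetry; exact: left_kan_class_invariant.
Qed.

Definition left_kan_comp (P : functor (opposite C) sets)
    (Q : functor (opposite D) sets) (t : nat_trans P (precomp F Q)) d :
    left_kan_obj P d -> Q d :=
  left_kan_lift
    (fun x => @res D Q d (F (pre_index x)) (pre_le x) (t _ (pre_val x))).

Lemma left_kan_compE (P : functor (opposite C) sets)
    (Q : functor (opposite D) sets) (t : nat_trans P (precomp F Q)) d
    c (h : leT d (F c)) p :
  left_kan_comp t (left_kan_class (LeftKanPre h p)) = @res D Q d (F c) h (t c p).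
Proof.
rewrite /left_kan_comp left_kan_liftE// => c' c2 u l l' p' /=.
rewrite res_nat.
have -> : l = (l' : hom (d : D) (F c')) \;c fmap F u by exact: le_eq.
by rewrite -(@res_comp D Q).
Qed.

Program Definition left_kan_untranspose (P : functor (opposite C) sets)
    (Q : functor (opposite D) sets) (t : nat_trans P (precomp F Q)) :
    nat_trans (left_kan_presheaf P) Q :=
  @NatTrans _ _ (left_kan_presheaf P) Q (left_kan_comp t) _.
Next Obligation.
move=> P Q t d d' h; apply: funext; apply: left_kan_ind => c l p /=.
rewrite left_kan_resE !left_kan_compE; symmetry; exact: (@res_comp D Q).
Qed.

Program Definition left_kan_adjunction : adjunction left_kan (precomp F) :=
  @Adjunction (presheaves C) (presheaves D) left_kan (precomp F)
    left_kan_transpose left_kan_untranspose _ _ _.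
Next Obligation.
move=> P Q t; apply: nat_trans_ext => d; apply: funext.
apply: left_kan_ind => c h p /=.
rewrite left_kan_compE /= -res_nat; congr (t _ _).
by rewrite [LHS]left_kan_resE; exact: left_kan_class_eq.
Qed.
Next Obligation.
move=> P Q t; apply: nat_trans_ext => c; apply: funext => p /=.
by rewrite left_kan_compE (@res_id D Q).
Qed.
Next Obligation.
move=> P P' Q Q' u t v; apply: nat_trans_ext => c; apply: funext => p /=.
by rewrite left_kan_mapE.
Qed.

Definition precomp_essential : essential_geometric (precomp F) :=
  EssentialGeometric right_kan_adjunction
    (fun J _ G k => right_adjoint_limit left_kan_adjunction (F := G) (k := k))
    left_kan_adjunction.

End kan.

(** * Analysis in C*-algebras *)

Section real_norm.
Local Open Scope complex_scope.
Variables (R : realType) (V : normedModType R[i]).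
Implicit Types x y z : V.

(** The norm takes values in [R[i]] with zero imaginary part; its real part allows linear and
    nonlinear real arithmetic. *)
Definition nrm x : R := complex.Re `|x|.

Lemma nrmE x : `|x| = (nrm x)%:C.
Proof.
have := normr_ge0 x; rewrite lecE /= => /andP[/eqP im0 _].
by rewrite /nrm; case: (`|x|) im0 => a b /= ->.
Qed.

Lemma nrm_ge0 x : 0 <= nrm x.
Proof. by rewrite -ler0c -nrmE. Qed.

Lemma nrmD x y : nrm (x + y) <= nrm x + nrm y.
Proof. by rewrite -lecR rmorphD /= -!nrmE ler_normD. Qed.

Lemma nrmN x : nrm (- x) = nrm x.
Proof. by rewrite /nrm normrN. Qed.

Lemma nrmB x y : nrm (x - y) <= nrm x + nrm y.
Proof. by rewrite -(nrmN y) nrmD. Qed.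

Lemma nrm_distC x y : nrm (x - y) = nrm (y - x).
Proof. by rewrite /nrm distrC. Qed.

Lemma nrm_distD z x y : nrm (x - y) <= nrm (x - z) + nrm (z - y).
Proof. by rewrite -[x - y](subrKA z) nrmD. Qed.

Lemma nrm0 : nrm (0 : V) = 0.
Proof. by rewrite /nrm normr0. Qed.

Lemma nrm0_eq0 x : nrm x = 0 -> x = 0.
Proof. by move=> x0; apply/normr0_eq0; rewrite nrmE x0. Qed.

Lemma nrmZ (r : R) x : nrm (r%:C *: x) = `|r| * nrm x.
Proof.
apply: complexI; rewrite rmorphM /= -!nrmE normrZ; congr (_ * _).
by rewrite normc_def /= expr0n /= addr0 sqrtr_sqr.
Qed.

Lemma nrmZi x : nrm ('i%C *: x) = nrm x.
Proof.
apply: complexI; rewrite -!nrmE normrZ normc_def /=.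
by rewrite expr0n expr1n add0r sqrtr1 mul1r.
Qed.

Lemma nrm_small0 x : (forall e, 0 < e -> nrm x < e) -> x = 0.
Proof.
move=> xe; apply: nrm0_eq0; apply/eqP; rewrite eq_le nrm_ge0 andbT leNgt.
by apply/negP => /xe; rewrite ltxx.
Qed.

Definition nlim (u : nat -> V) (l : V) :=
  forall e : R, 0 < e -> exists N, forall n, (N <= n)%N -> nrm (u n - l) < e.

Lemma gt0_complex (e : R[i]) : 0 < e -> e = (complex.Re e)%:C /\ 0 < complex.Re e.
Proof. by case: e => a b; rewrite ltcE /= => /andP[/eqP -> ->]. Qed.

Lemma cvg_nlim u l : u @ \oo --> l -> nlim u l.
Proof.
move=> /cvgrPdist_lt ul e e0.
have [|N _ NP] := ul e%:C; first by rewrite ltcR.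
by exists N => n Nn; have := NP n Nn; rewrite nrmE ltcR nrm_distC.
Qed.

Lemma closure_nrm (S : set V) x :
  closure S x <-> forall e : R, 0 < e -> exists2 y, S y & nrm (x - y) < e.
Proof.
split=> [Sx e e0|Sx N].
  have [|y [Sy]] := Sx (ball x e%:C); first by apply: nbhsx_ballx; rewrite ltcR.
  by rewrite -ball_normE /= nrmE ltcR => yx; exists y.
rewrite -nbhs_ballE => -[e /= /gt0_complex[-> e0] eN].
have [y Sy yx] := Sx _ e0; exists y; split=> //; apply: eN.
by rewrite -ball_normE /= nrmE ltcR.
Qed.

Lemma closed_nlim (S : set V) u l :
  closed S -> (forall n, S (u n)) -> nlim u l -> S l.
Proof.
move=> cS Su ul; apply: cS; apply/closure_nrm => e /ul[N NP].
by exists (u N) => //; rewrite nrm_distC NP.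
Qed.

End real_norm.

(** * Geometric convergence and the contraction principle *)

Section geometric_limit.
Local Open Scope complex_scope.
Variables (R : realType) (V : completeNormedModType R[i]).

Lemma geometric_nlim (u : nat -> V) (M q : R) : 0 <= q -> q < 1 ->
  (forall n, nrm (u n.+1 - u n) <= M * q ^+ n) -> exists l, nlim u l.
Proof.
move=> q0 q1 uM.
have M0 : 0 <= M.
  by have := uM 0%N; rewrite expr0 mulr1; apply: le_trans; exact: nrm_ge0.
have q1' : 0 < 1 - q by rewrite subr_gt0.
(* The exact partial sum of the geometric series is kept, so that the induction step closes with an
   equality. *)
have dist n k : nrm (u (n + k)%N - u n) <= M / (1 - q) * (q ^+ n - q ^+ (n + k)%N).
  elim: k => [|k ih]; first by rewrite addn0 !subrr nrm0 mulr0.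
  apply: le_trans (nrm_distD (u (n + k)%N) _ _) _.
  rewrite addnS; apply: le_trans (lerD (uM _) ih) _.
  rewrite le_eqVlt; apply/orP; left; apply/eqP; rewrite exprS.
  by field; rewrite gt_eqF.
suff /cvg_ex[l ul] : cvg (u @ \oo) by exists l; exact: cvg_nlim.
apply/cauchy_cvgP.
apply: cauchy_exP => e /gt0_complex[-> e0].
have /cvgrPdist_lt/(_ _ e0)[N _ NP] : geometric (M / (1 - q)) q @ \oo --> (0 : R).
  by apply: cvg_geometric; rewrite ger0_norm.
exists (u N); exists N => // n /= Nn; rewrite -ball_normE /= nrmE ltcR nrm_distC.
have {NP} := NP N (leqnn N); rewrite /= sub0r normrN => /ltr_normlW; apply: le_lt_trans.
rewrite -(subnKC Nn); apply: le_trans (dist _ _) _.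
by rewrite ler_wpM2l ?divr_ge0 ?(ltW q1')// gerBl exprn_ge0.
Qed.

(** Banach's contraction principle: the steps of the iteration decay like [q ^+ n], so the iterates
    converge, and the limit stays in the closed set [U]. *)
Lemma nrm_fixed_point (U : set V) (f : V -> V) (q : R) :
  closed U -> U !=set0 -> (forall x, U x -> U (f x)) -> 0 <= q -> q < 1 ->
  (forall x y, U x -> U y -> nrm (f x - f y) <= q * nrm (x - y)) ->
  exists2 x, U x & f x = x.
Proof.
move=> cU [x0 Ux0] fU q0 q1 fq.
pose u n := iter n f x0.
have Uu n : U (u n) by elim: n => //= n; exact: fU.
have [|l ul] := @geometric_nlim u (nrm (f x0 - x0)) q q0 q1.
  elim=> [|n ih]; first by rewrite expr0 mulr1.
  apply: le_trans (fq (u n.+1) (u n) (Uu _) (Uu _)) _.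
  by rewrite exprS mulrCA ler_wpM2l.
have Ul : U l by exact: closed_nlim ul.
exists l => //; apply/eqP; rewrite -subr_eq0; apply/eqP.
apply: nrm_small0 => e e0; have [N NP] := ul (e / 2) (divr_gt0 e0 (ltr0Sn _ 1)).
apply: le_lt_trans (nrm_distD (u N.+1) _ _) _.
rewrite [ltRHS]splitr; apply: ltrD; last exact: NP.
rewrite nrm_distC; apply: le_lt_trans (fq (u N) l (Uu _) Ul) _.
apply: le_lt_trans (NP N (leqnn N)).
by rewrite ler_piMl ?nrm_ge0// ltW.
Qed.

End geometric_limit.

(** * Square roots, unitaries and resolvents *)

Section cstar_algebra.
Local Open Scope complex_scope.
Variables (R : realType) (A : cstarAlgType R).
Implicit Types (x y z a b : A) (C : context A).

Lemma cmulNx x y : (- x) \*c y = - (x \*c y).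
Proof. by rewrite -scaleN1r cmulZl scaleN1r. Qed.

Lemma cmulxN x y : x \*c (- y) = - (x \*c y).
Proof. by rewrite -scaleN1r cmulZr scaleN1r. Qed.

Lemma cmulBl x y z : (x - y) \*c z = x \*c z - y \*c z.
Proof. by rewrite cmulDl cmulNx. Qed.

Lemma cmulBr x y z : x \*c (y - z) = x \*c y - x \*c z.
Proof. by rewrite cmulDr cmulxN. Qed.

Lemma starN x : star (- x) = - star x.
Proof. by rewrite -scaleN1r starZ rmorphN rmorph1 scaleN1r. Qed.

Lemma starB x y : star (x - y) = star x - star y.
Proof. by rewrite starD starN. Qed.

Lemma star1 : star (cunit : A) = cunit.
Proof. by rewrite -[LHS]cmul1x -[X in X \*c _]starK -starM cmul1x starK. Qed.

Lemma starZR (r : R) x : star (r%:C *: x) = r%:C *: star x.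
Proof.
rewrite starZ; congr (_ *: _).
by apply/eqP; rewrite eq_complex /= oppr0 !eqxx.
Qed.

Lemma starZi x : star ('i%C *: x) = - ('i%C *: star x).
Proof.
rewrite starZ -scaleNr; congr (_ *: _).
by apply/eqP; rewrite eq_complex /= oppr0 !eqxx.
Qed.

Lemma scaleii x : 'i%C *: ('i%C *: x) = - x.
Proof. by rewrite scalerA -expr2 sqr_i scaleN1r. Qed.

Lemma nrmM x y : nrm (x \*c y) <= nrm x * nrm y.
Proof. by rewrite -lecR rmorphM /= -!nrmE norm_cmul_le. Qed.

Lemma nrm_star_mul x : nrm (star x \*c x) = nrm x ^+ 2.
Proof. by apply: complexI; rewrite rmorphXn /= -!nrmE norm_star. Qed.

(** The C*-identity gives [|y|^2 <= |star y| |y|]; cancel [|y|], then use this for [x] and for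
    [star x]. *)
Lemma nrm_star x : nrm (star x) = nrm x.
Proof.
have le y : nrm y <= nrm (star y).
  have [->|y0] := eqVneq (nrm y) 0; first exact: nrm_ge0.
  have yp : 0 < nrm y by rewrite lt_neqAle eq_sym y0 nrm_ge0.
  by rewrite -(ler_pM2r yp) -expr2 -nrm_star_mul nrmM.
by apply/eqP; rewrite eq_le le andbT -{2}(starK x) le.
Qed.

(** The C*-identity makes [|1|] idempotent; it is 0 in the zero algebra, hence only an
    inequality. *)
Lemma nrm1 : nrm (cunit : A) <= 1.
Proof.
have := nrm_star_mul (cunit : A); rewrite star1 cmul1x => n1.
have := nrm_ge0 (cunit : A); nra.
Qed.

Lemma half_double x : 2^-1%:C *: x + 2^-1%:C *: x = x.
Proof. by rewrite -scalerDl -rmorphD /= -[2^-1]mul1r -splitr scale1r. Qed.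

Let sqrt_map b z := 2^-1%:C *: (b + z \*c z).

(** Even without commutation, [z^2 - y^2 = z (z - y) + (z - y) y], and the factor 1/2 absorbs the
    two terms. *)
Let sqrt_map_contraction b (k : R) z y : nrm z <= k -> nrm y <= k ->
  nrm (sqrt_map b z - sqrt_map b y) <= k * nrm (z - y).
Proof.
move=> zk yk; rewrite -scalerBr nrmZ opprD addrACA subrr add0r.
rewrite -(subrKA (z \*c y)) -cmulBr -cmulBl.
have := nrmD (z \*c (z - y)) ((z - y) \*c y).
have := nrmM z (z - y); have := nrmM (z - y) y.
have := ler_wpM2r (nrm_ge0 (z - y)) zk.
have := ler_wpM2l (nrm_ge0 (z - y)) yk.
rewrite ger0_norm ?invr_ge0//; lra.
Qed.

(* z = 1 - sqrt (1 - b), the fixed point of z |-> (b + z^2) / 2; uniqueness of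
   the fixed point makes it self-adjoint. *)
Lemma sqrt_exists b : star b = b -> nrm b < 1 ->
  exists z, [/\ star z = z, z + z = b + z \*c z &
    forall a, a \*c b = b \*c a -> a \*c z = z \*c a].
Proof.
move=> bsa b1; pose k := nrm b.
have k0 : 0 <= k by exact: nrm_ge0.
(* Both the self-adjointness of [z] and its commutation with [a] reduce to this, as [k < 1]. *)
have fixed0 y : nrm y <= k * nrm y -> y = 0.
  by move=> yk; apply: nrm0_eq0; have := nrm_ge0 y; rewrite /k in yk *; nra.
have [||||z /= zk zfix] := @nrm_fixed_point R A [set z | nrm z <= k]
  (sqrt_map b) k _ _ _ k0 b1.
- move=> x /closure_nrm xk /=; apply/ler_addgt0Pr => e /xk[y /= yk yx].
  by have := nrmD (x - y) y; rewrite subrK; lra.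
- by exists 0; rewrite /= nrm0.
(* The ball of radius [k] is stable because [(k + k^2) / 2 <= k]. *)
- move=> z /= zk; rewrite /sqrt_map nrmZ ger0_norm ?invr_ge0//.
  have := nrmD b (z \*c z); have := nrmM z z; have := nrm_ge0 z.
  by rewrite -/k; rewrite /k in zk *; nra.
- by move=> z y; exact: sqrt_map_contraction.
exists z; split.
- apply/eqP; rewrite -subr_eq0; apply/eqP/fixed0.
  have szfix : sqrt_map b (star z) = star z.
    by rewrite -[in RHS]zfix starZR starD starM bsa.
  have := @sqrt_map_contraction b k (star z) z; rewrite szfix zfix.
  by apply=> //; rewrite nrm_star.
- by rewrite -{1 2}zfix half_double.
- move=> a ab; apply/eqP; rewrite -subr_eq0; apply/eqP/fixed0.
  (* The commutator [d] of [a] and [z] satisfies [d = (d z + z d) / 2], whence [|d| <= k |d|]. *)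
  have comm_fix : a \*c z - z \*c a =
      2^-1%:C *: ((a \*c z - z \*c a) \*c z + z \*c (a \*c z - z \*c a)).
    transitivity (a \*c sqrt_map b z - sqrt_map b z \*c a); first by rewrite zfix.
    rewrite cmulZr cmulZl -scalerBr.
    rewrite cmulDr cmulDl ab opprD addrACA subrr add0r; congr (_ *: _).
    by rewrite cmulBl cmulBr !cmulA subrKA.
  rewrite {1}comm_fix nrmZ ger0_norm ?invr_ge0//; set d := _ - _.
  have := nrmD (d \*c z) (z \*c d); have := nrmM d z; have := nrmM z d.
  have := ler_wpM2l (nrm_ge0 d) zk.
  lra.
Qed.

(* u = a + i sqrt (1 - a^2) *)
Lemma unitary_dilation a : star a = a -> nrm a < 1 ->
  exists u, star u \*c u = cunit /\ a = 2^-1%:C *: (u + star u).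
Proof.
move=> asa a1.
have [||z [zsa zz zcomm]] := @sqrt_exists (a \*c a).
- by rewrite starM asa.
- by apply: le_lt_trans (nrmM _ _) _; have := nrm_ge0 a; nra.
have az := zcomm a (cmulA _ _ _).
(* Since [2 z = a^2 + z^2], the square of [1 - z] is [1 - a^2]. *)
pose c := cunit - z.
have ac : a \*c c = c \*c a by rewrite cmulBr cmulBl cmulx1 cmul1x az.
have cc : c \*c c = cunit - a \*c a.
  rewrite /c cmulBl cmul1x cmulBr cmulx1 -addrA -opprD.
  by rewrite [z + (z - _)]addrA zz addrK.
exists (a + 'i *: c); rewrite starD starZi asa starB star1 zsa -/c; split.
  rewrite cmulBl !cmulDr !cmulZl !cmulZr scaleii ac cc.
  by rewrite opprD opprK addrA addrK addrC subrK.
by rewrite addrACA subrr addr0 scalerDr half_double.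
Qed.

(* The C*-identity gives |1 + i e a| <= 1 + O(e^2), so that
   e (1 - i a) = (1 + e) - (1 + i e a) is inverted by a contraction. *)
Lemma resolvent_exists C a : carrier C a -> star a = a ->
  exists y, [/\ carrier C y, y - 'i *: (a \*c y) = cunit & nrm y <= 2].
Proof.
move=> Ca asa; pose m := nrm a ^+ 2.
have m0 : 0 <= m by exact: sqr_ge0.
(* Chosen so that [e^2 m <= e / 2], which gives [|w| <= 1 + e / 2], strictly below [1 + e]. *)
pose e : R := (2 * (m + 1))^-1.
have e0 : 0 < e by rewrite invr_gt0; lra.
have eE : e * (2 * (m + 1)) = 1 by rewrite mulVf// gt_eqF//; lra.
pose w := cunit + e%:C *: ('i *: a).
have w2 : nrm w ^+ 2 <= 1 + e ^+ 2 * m.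
  have <- : nrm (cunit + (e ^+ 2)%:C *: (a \*c a)) = nrm w ^+ 2.
    rewrite -nrm_star_mul /w starD star1 starZR starZi asa scalerN; congr nrm.
    have : ('i *: a) \*c ('i *: a) = - (a \*c a) by rewrite cmulZl cmulZr scaleii.
    move: ('i *: a) => v vv; rewrite cmulBl cmul1x cmulDr cmulx1 cmulZl cmulZr vv.
    by rewrite opprD addrA addrK !scalerN opprK scalerA -rmorphM -expr2.
  apply: le_trans (nrmD _ _) _; apply: lerD; first exact: nrm1.
  by rewrite nrmZ ger0_norm ?sqr_ge0// ler_wpM2l ?sqr_ge0// /m expr2 nrmM.
have w1 : nrm w <= 1 + e / 2.
  have em : e ^+ 2 * m <= e / 2 by nra.
  by have := nrm_ge0 w; nra.
have q0 : 0 < 1 + e by lra.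
(* A fixed point solves [((1 + e) - w) y = e], which is [e (1 - i a) y = e]. Iterating inside the
   closed set [carrier C] keeps the solution in [C]. *)
pose f y := (1 + e)^-1%:C *: (w \*c y + e%:C *: cunit).
have [|||||y Cy yfix] := @nrm_fixed_point R A (carrier C) f ((1 + e / 2) / (1 + e))
  (@context_closed _ _ C) _ _.
- by exists cunit; exact: context1.
- move=> y Cy; apply: contextZ; apply: contextD; last by apply/contextZ/context1.
  apply: contextM => //; apply: contextD; first exact: context1.
  by do 2!apply: contextZ.
- by rewrite divr_ge0//; lra.
- by rewrite ltr_pdivrMr//; lra.
- move=> y z _ _; rewrite -scalerBr opprD addrACA subrr addr0 -cmulBr nrmZ.
  rewrite ger0_norm ?invr_ge0 ?(ltW q0)// [_ / (1 + e)]mulrC -mulrA.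
  rewrite ler_wpM2l ?invr_ge0 ?(ltW q0)//.
  by apply: le_trans (nrmM _ _) _; rewrite ler_wpM2r ?nrm_ge0.
have {yfix}yfix : (1 + e)%:C *: y = w \*c y + e%:C *: cunit.
  by rewrite -{1}yfix scalerA -rmorphM /= divff ?gt_eqF// scale1r.
exists y; split=> //.
  have en0 : e%:C != 0 by rewrite gt_eqF// ltcR.
  apply: (scalerI en0); move/eqP: yfix; rewrite rmorphD rmorph1 scalerDl scale1r.
  rewrite /w cmulDl cmul1x -addrA (inj_eq (addrI _)) => /eqP ey.
  by rewrite scalerBr ey !cmulZl addrAC subrr add0r.
(* With [|w| <= 1 + e / 2] this leaves [(e / 2) |y| <= e], the source of the bound 2. *)
have : nrm ((1 + e)%:C *: y) <= nrm w * nrm y + e.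
  rewrite yfix; apply: le_trans (nrmD _ _) _; apply: lerD; first exact: nrmM.
  by rewrite nrmZ gtr0_norm// ler_piMr ?(ltW e0)// nrm1.
rewrite nrmZ gtr0_norm//; have := ler_wpM2r (nrm_ge0 y) w1 => wy ye.
have : e * nrm y <= e * 2 by lra.
by rewrite ler_pM2l.
Qed.

End cstar_algebra.

(** * The image of a context is closed *)

Section star_morphism_image.
Local Open Scope complex_scope.
Variables (R : realType) (A B : cstarAlgType R) (phi : star_morphism A B).
Implicit Types (x a : A) (y : B) (C : context A).

Lemma star_morphD : {morph phi : x y / x + y}.
Proof. by move=> x y; have := star_linear phi 1 x y; rewrite !scale1r. Qed.

Lemma star_morph0 : phi 0 = 0.
Proof. by apply: (addrI (phi 0)); rewrite -star_morphD !addr0. Qed.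

Lemma star_morphZ k x : phi (k *: x) = k *: phi x.
Proof. by have := star_linear phi k x 0; rewrite star_morph0 !addr0. Qed.

Lemma star_morphN : {morph phi : x / - x}.
Proof. by move=> x; rewrite -scaleN1r star_morphZ scaleN1r. Qed.

Lemma star_morphB : {morph phi : x y / x - y}.
Proof. by move=> x y; rewrite star_morphD star_morphN. Qed.

Lemma unitary_nrm y : star y \*c y = cunit -> nrm y <= 1.
Proof.
move=> yu; have := nrm_star_mul y; rewrite yu => yE.
have := nrm1 B; have := nrm_ge0 y; nra.
Qed.

Lemma star_morph_contractive x : nrm (phi x) <= nrm x.
Proof.
have sa1 a : star a = a -> nrm a < 1 -> nrm (phi a) <= 1.
  move=> asa /(unitary_dilation asa)[u [uu ->]].
  have pu : nrm (phi u) <= 1.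
    by apply: unitary_nrm; rewrite -star_star -star_mul uu star_unit.
  rewrite star_morphZ star_morphD star_star nrmZ ger0_norm ?invr_ge0//.
  have := nrmD (phi u) (star (phi u)); rewrite nrm_star; lra.
have sa a : star a = a -> nrm (phi a) <= nrm a.
  move=> asa; apply/ler_addgt0Pr => e e0.
  (* Dividing by [|a| + e] instead of [|a|] makes the norm strictly less than 1 and covers
     [a = 0]. *)
  have t0 : 0 < nrm a + e by have := nrm_ge0 a; lra.
  have := sa1 ((nrm a + e)^-1%:C *: a).
  rewrite starZR asa star_morphZ !nrmZ gtr0_norm ?invr_gt0// => /(_ erefl).
  by rewrite ![_^-1 * _]mulrC ltr_pdivrMr// ler_pdivrMr// !mul1r; apply; lra.
(* The self-adjoint case at [star x \*c x] compares the squares of the two norms. *)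
have := sa (star x \*c x); rewrite starM starK star_mul star_star !nrm_star_mul.
by move=> /(_ erefl); rewrite ler_sqr ?nnegrE ?nrm_ge0.
Qed.

Lemma star_morph_nlim (u : nat -> A) l : nlim u l -> nlim (phi \o u) (phi l).
Proof.
move=> ul e /ul[N NP]; exists N => n /NP; apply: le_lt_trans => /=.
by rewrite -star_morphB star_morph_contractive.
Qed.

(* With y = (1 - i s a)^-1 and s = 1/(8r), the lift is f = a y = (y - 1)/(i s);
   its image differs from phi a by - i s (phi a)^2 (phi y). *)
Lemma self_adjoint_lift C a (r : R) :
  carrier C a -> star a = a -> 0 < r -> nrm (phi a) <= r ->
  exists f, [/\ carrier C f, nrm f <= 24 * r & nrm (phi a - phi f) <= r / 4].
Proof.
move=> Ca asa r0 ar; pose s := (8 * r)^-1.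
have s0 : 0 < s by rewrite invr_gt0; lra.
have sE : s * (8 * r) = 1 by rewrite mulVf// gt_eqF//; lra.
have [||y [Cy yE y2]] := @resolvent_exists R A C (s%:C *: a).
- exact: contextZ.
- by rewrite starZR asa.
exists (a \*c y); split; first exact: contextM.
  (* Up to the factor [i] this is [y - 1], of norm at most 2 + 1; dividing by [s = 1/(8r)] gives 24
     r. *)
  have : nrm (s%:C *: (a \*c y)) <= 3.
    rewrite -nrmZi -cmulZl; have -> : 'i *: ((s%:C *: a) \*c y) = y - cunit.
      by rewrite -yE opprB addrC subrK.
    by apply: le_trans (nrmB _ _) _; have := nrm1 A; lra.
  rewrite nrmZ gtr0_norm// => sf.
  have : s * nrm (a \*c y) <= s * (24 * r) by lra.
  by rewrite ler_pM2l.
have -> : phi a - phi (a \*c y) = - ('i *: (s%:C *: (phi a \*c (phi a \*c phi y)))).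
  rewrite -star_morphB -{1}[a]cmulx1 -yE cmulBr addrAC subrr add0r.
  by rewrite star_morphN !(cmulZl, cmulZr, star_morphZ, star_mul).
rewrite nrmN nrmZi nrmZ gtr0_norm//.
have py : nrm (phi y) <= 2 by apply: le_trans (star_morph_contractive _) _.
have h1 := nrmM (phi a) (phi a \*c phi y).
have h2 := nrmM (phi a) (phi y).
have a0 := nrm_ge0 (phi a); have y0 := nrm_ge0 (phi y).
have h3 : nrm (phi a) * nrm (phi y) <= r * 2 by exact: ler_pM.
have h4 : nrm (phi a \*c (phi a \*c phi y)) <= r * (r * 2).
  by apply: le_trans h1 _; apply: ler_pM => //; [exact: nrm_ge0|lra].
have h5 : s * nrm (phi a \*c (phi a \*c phi y)) <= s * (r * (r * 2)).
  by rewrite ler_pM2l.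
apply: le_trans h5 _.
(* The error is at most [s * 2 r^2], where the 8 in [s] yields [r / 4]. *)
have -> : s * (r * (r * 2)) = (s * (8 * r)) * (r / 4) by field.
by rewrite sE mul1r.
Qed.

(** Lift the real and imaginary parts of [x] separately: their images have norm at most [|phi x|],
    so the bounds 24 and 1/4 double. *)
Lemma approximate_lift C x : carrier C x ->
  exists f, [/\ carrier C f, nrm f <= 48 * nrm (phi x) &
    nrm (phi x - phi f) <= nrm (phi x) / 2].
Proof.
move=> Cx; have [x0|x0] := eqVneq (nrm (phi x)) 0.
  exists 0; split; last by rewrite star_morph0 subr0 x0 mul0r.
  - by rewrite -(scale0r x); exact: contextZ.
  - by rewrite nrm0 x0 mulr0.
have r0 : 0 < nrm (phi x) by rewrite lt_neqAle eq_sym x0 nrm_ge0.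
pose a := 2^-1%:C *: (x + star x); pose b := 2^-1%:C *: ('i *: (star x - x)).
have Cs : carrier C (star x) by exact: context_star.
have CB z w : carrier C z -> carrier C w -> carrier C (z - w).
  by move=> Cz Cw; apply: contextD => //; rewrite -scaleN1r; exact: contextZ.
have [|||f [Cf f1 f2]] := @self_adjoint_lift C a (nrm (phi x)) _ _ r0.
- by apply/contextZ/contextD.
- by rewrite starZR starD starK addrC.
- rewrite star_morphZ star_morphD star_star nrmZ ger0_norm ?invr_ge0//.
  by have := nrmD (phi x) (star (phi x)); rewrite nrm_star; lra.
have [|||g [Cg g1 g2]] := @self_adjoint_lift C b (nrm (phi x)) _ _ r0.
- by apply/contextZ/contextZ/CB.
- by rewrite starZR starZi starB starK -scalerN opprB.
- rewrite !star_morphZ star_morphB star_star nrmZ nrmZi ger0_norm ?invr_ge0//.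
  by have := nrmB (star (phi x)) (phi x); rewrite nrm_star; lra.
have xE : x = a + 'i *: b.
  rewrite /a /b scalerA [_ * _]mulrC -scalerA scaleii opprB scalerDr scalerBr.
  by rewrite addrACA subrr addr0 half_double.
exists (f + 'i *: g); split.
- by apply/contextD => //; exact: contextZ.
- by apply: le_trans (nrmD _ _) _; rewrite nrmZi; lra.
rewrite {1}xE (star_morphD a) (star_morphD f) (star_morphZ _ b) (star_morphZ _ g).
rewrite opprD addrACA -scalerBr.
by apply: le_trans (nrmD _ _) _; rewrite nrmZi; lra.
Qed.

(** Approximating [y] by [phi x] within [|y| / 8] gives [|phi x| <= 9/8 |y|]. Then 48 * 9/8 = 54,
    and the error 1/8 + 9/16 is below 3/4. *)
Lemma closure_lift C y : closure (phi @` carrier C) y ->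
  exists x, [/\ carrier C x, nrm x <= 54 * nrm y & nrm (y - phi x) <= 3 / 4 * nrm y].
Proof.
move=> /closure_nrm Cy; have [y0|y0] := eqVneq (nrm y) 0.
  exists 0; split; last by rewrite star_morph0 subr0 y0 mulr0.
  - by rewrite -(scale0r cunit); apply/contextZ/context1.
  - by rewrite nrm0 y0 mulr0.
have r0 : 0 < nrm y by rewrite lt_neqAle eq_sym y0 nrm_ge0.
have [|_ [x Cx <-] xy] := Cy (nrm y / 8); first by lra.
have [f [Cf f1 f2]] := approximate_lift Cx.
have px : nrm (phi x) <= nrm y + nrm y / 8.
  by have := nrmB y (y - phi x); rewrite subKr; lra.
exists f; split=> //; first by lra.
by apply: le_trans (nrm_distD (phi x) _ _) _; lra.
Qed.

Lemma image_closed C : closed (phi @` carrier C).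
Proof.
move=> y Cy.
have clB z x : closure (phi @` carrier C) z -> carrier C x ->
    closure (phi @` carrier C) (z - phi x).
  move=> /closure_nrm Cz Cx; apply/closure_nrm => e /Cz[_ [w Cw <-] wz].
  exists (phi w - phi x); last by rewrite opprB addrA subrK.
  exists (w - x); last exact: star_morphB.
  by apply: contextD => //; rewrite -scaleN1r; exact: contextZ.
(* A choice function for corrections, with default value 0 off the closure. *)
have /choice[g gP] z : exists x, closure (phi @` carrier C) z ->
    [/\ carrier C x, nrm x <= 54 * nrm z & nrm (z - phi x) <= 3 / 4 * nrm z].
  have [/closure_lift[x xP]|nz] := pselect (closure (phi @` carrier C) z).
    by exists x.
  by exists 0.
pose u := fix u n := if n is m.+1 then u m + g (y - phi (u m)) else 0.
(* The residual stays in the closure because [u n] lies in [C], so it can be corrected again,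
   shrinking by 3/4 each time. *)
have uP n : [/\ carrier C (u n), closure (phi @` carrier C) (y - phi (u n)) &
    nrm (y - phi (u n)) <= nrm y * (3 / 4) ^+ n].
  elim: n => [|n [Cu clu nu]] /=.
    rewrite star_morph0 subr0 expr0 mulr1; split=> //.
    by rewrite -(scale0r cunit); apply/contextZ/context1.
  have [Cg g1 g2] := gP _ clu; rewrite star_morphD opprD addrA.
  split; [exact: contextD|exact: clB|].
  apply: le_trans g2 _; rewrite exprS mulrCA ler_wpM2l//; lra.
have [|||l ul] := @geometric_nlim R A u (54 * nrm y) (3 / 4); [lra|lra| |].
  move=> n /=; rewrite addrC addKr; have [Cu clu nu] := uP n.
  by have [_ g1 _] := gP _ clu; apply: le_trans g1 _; rewrite -mulrA ler_wpM2l.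
exists l.
  apply: closed_nlim ul; first exact: context_closed.
  by move=> n; have [] := uP n.
apply/eqP; rewrite -subr_eq0; apply/eqP/nrm_small0 => e e0.
have e2 : 0 < e / 2 by lra.
have [N NP] := star_morph_nlim ul e2.
have [M MP] : exists M, forall n, (M <= n)%N -> nrm (y - phi (u n)) < e / 2.
  have /cvgrPdist_lt/(_ _ e2)[M _ MP] : geometric (nrm y) (3 / 4) @ \oo --> (0 : R).
    by apply: cvg_geometric; rewrite ger0_norm; lra.
  exists M => n /MP; rewrite /= sub0r normrN => /ltr_normlW.
  by apply: le_lt_trans; have [] := uP n.
(* At a common index, [phi (u n)] is within [e / 2] of both [phi l] and [y]. *)
have := NP (maxn M N) (leq_maxr _ _); have := MP (maxn M N) (leq_maxl _ _).
have := nrm_distD (phi (u (maxn M N))) (phi l) y.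
rewrite nrm_distC [nrm (phi (u _) - y)]nrm_distC [nrm (phi l - phi (u _))]nrm_distC /=.
lra.
Qed.

Program Definition image_context C : context B :=
  @Context R B (phi @` carrier C) _ _ _ _ _ _ _.
Next Obligation. by move=> C; exists cunit; [exact: context1|exact: star_unit]. Qed.
Next Obligation.
move=> C _ _ [x Cx <-] [y Cy <-]; exists (x + y); first exact: contextD.
exact: star_morphD.
Qed.
Next Obligation.
move=> C k _ [x Cx <-]; exists (k *: x); first exact: contextZ.
exact: star_morphZ.
Qed.
Next Obligation.
move=> C _ _ [x Cx <-] [y Cy <-]; exists (x \*c y); first exact: contextM.
exact: star_mul.
Qed.
Next Obligation.
move=> C _ [x Cx <-]; exists (star x); first exact: context_star.
exact: star_star.
Qed.
Next Obligation. by move=> C; exact: image_closed. Qed.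
Next Obligation.
by move=> C _ _ [x Cx <-] [y Cy <-]; rewrite -!star_mul (context_comm Cx Cy).
Qed.

End star_morphism_image.

(** * The induced map of spectral presheaves *)

Section spectral_map.
Variables (R : realType) (A B : cstarAlgType R) (phi : star_morphism A B).

Lemma image_context_mono (C' C : context A) :
  C' `<=` C -> image_context phi C' `<=` image_context phi C.
Proof. exact: image_subset. Qed.

Lemma image_context_image (C : context A) : phi @` C = image_context phi C.
Proof. by []. Qed.

Program Definition pullback_character (C : context A)
    (l : spectrum (image_context phi C)) : spectrum C :=
  @Character R A C (l \o corestriction (image_context_image C)) _ _.
Next Obligation.
move=> C l a x y /=; rewrite -character_linear; congr (l _).
by apply: val_inj; rewrite /= star_linear.
Qed.
Next Obligation.
move=> C l; have [l1 lM] := character_mul l.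
split=> [|x y] /=; first by rewrite -l1; congr (l _); apply: val_inj; exact: star_unit.
by rewrite -lM; congr (l _); apply: val_inj; exact: star_mul.
Qed.

Program Definition spectral_trans :
    nat_trans (precomp (monotone_functor image_context_mono) (spectral_presheaf B))
      (spectral_presheaf A) :=
  @NatTrans _ _ (precomp (monotone_functor image_context_mono) (spectral_presheaf B))
    (spectral_presheaf A) pullback_character _.
Next Obligation.
move=> C C' h; apply: funext => l; apply: spectrum_ext => x /=.
by congr (l _); exact: val_inj.
Qed.

End spectral_map.

Theorem proposition3p3 (R : realType) (A B : cstarAlgType R)
    (phi : star_morphism A B) :
  exists (phit : context A -> context B)
         (phit_image : forall C : context A, phi @` C = phit C)
         (phit_mono : forall C' C : context A, C' `<=` C -> phit C' `<=` phit C)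
         (Phi : essential_geometric (precomp (monotone_functor phit_mono)))
         (G : nat_trans
                (precomp (monotone_functor phit_mono) (spectral_presheaf B))
                (spectral_presheaf A))
         (m : spectral_presheaf_map B A),
    m = PresheafMap (map_geom := EssentialGeometricMorphism Phi) G /\
    forall (C : context A) (l : spectrum (phit C)),
      (G C l : spectrum C) = l \o corestriction (phit_image C) :> (_ -> _).
Proof.
exists (image_context phi), (image_context_image phi), (@image_context_mono R A B phi).
exists (precomp_essential (monotone_functor (@image_context_mono R A B phi))).
by exists (spectral_trans phi); eexists; split.
Qed.
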